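(* Consider the Gaussian MIMO $K$-receiver wiretap channel with fixed channels $\mathbf{H}_1,\dots,\mathbf{H}_K,\mathbf{G}$, total power $P>0$, and fixed nonnegative weights $w_1,\dots,w_K$ summing to one. For each permutation $\pi$ of $\{1,\dots,K\}$ let $$\varphi_\pi(P)=\max_{\mathbf{Q}_{1},\dots,\mathbf{Q}_{K}\succcurlyeq\mathbf{0},\ \sum_k\mathrm{tr}(\mathbf{Q}_k)\le P}\ \sum_{k=1}^K w_{\pi_k}R_{\pi_k}$$ be the maximal weighted secrecy sum-rate achievable with encoding order $\pi$. Then a permutation $\pi^*$ whose weights are ordered so that $w_{\pi^*_1}\ge w_{\pi^*_2}\ge\cdots\ge w_{\pi^*_K}$ (equivalently, the corresponding decoding order, which is the reverse of $\pi^*$, has nondecreasing weights) satisfies $\varphi_{\pi^*}(P)=\max_{\pi}\varphi_{\pi}(P)$. In other words, a receiver with a larger weight should be encoded earlier, exactly as in the MIMO broadcast channel without secrecy, and a single encoding order (determined by the weights) suffices to attain the maximum weighted secrecy sum-rate, hence each boundary point of the secrecy capacity region supporting the weight vector $(w_1,\dots,w_K)$, without enumerating all $K!$ orders.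
   Context: Gaussian MIMO $K$-receiver wiretap channel: transmitter with $n_t$ antennas, receiver $k$ observes $\mathbf{y}_k=\mathbf{H}_k\mathbf{x}+\mathbf{w}_k$ ($\mathbf{H}_k\in\mathbb{C}^{n_k\times n_t}$), eavesdropper observes $\mathbf{y}_e=\mathbf{G}\mathbf{x}+\mathbf{w}_e$ ($\mathbf{G}\in\mathbb{C}^{n_e\times n_t}$), noises circularly symmetric complex Gaussian with identity covariance; input $\mathbf{x}=\sum_k\mathbf{x}_k$, $\mathbf{x}_k\sim\mathcal{CN}(0,\mathbf{Q}_k)$ independent, $\mathbf{Q}_k\succcurlyeq\mathbf{0}$. With (secret) dirty-paper encoding order $\pi=[\pi_1,\dots,\pi_K]$ (receiver $\pi_1$ encoded first), the secrecy rate of receiver $\pi_k$ is $$R_{\pi_k}=\log\frac{\big|\mathbf{I}+\mathbf{H}_{\pi_k}\big(\sum_{j=k}^K\mathbf{Q}_{\pi_j}\big)\mathbf{H}_{\pi_k}^\dagger\big|}{\big|\mathbf{I}+\mathbf{H}_{\pi_k}\big(\sum_{j=k+1}^K\mathbf{Q}_{\pi_j}\big)\mathbf{H}_{\pi_k}^\dagger\big|}-\log\frac{\big|\mathbf{I}+\mathbf{G}\big(\sum_{j=k}^K\mathbf{Q}_{\pi_j}\big)\mathbf{G}^\dagger\big|}{\big|\mathbf{I}+\mathbf{G}\big(\sum_{j=k+1}^K\mathbf{Q}_{\pi_j}\big)\mathbf{G}^\dagger\big|},$$ empty sums being $\mathbf{0}$, logarithms natural, $^\dagger$ conjugate transpose,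 $|\cdot|$ determinant. The secrecy capacity region under total power $P$ is the convex closure of the union over all permutations $\pi$ of the achievable rate sets of this form with $\sum_k\mathrm{tr}(\mathbf{Q}_k)\le P$. *)

(* Defs.v *)
From HB Require Import structures.
From mathcomp Require Import all_boot all_order all_algebra all_fingroup.
From mathcomp Require Import all_classical all_reals all_analysis.
From mathcomp.real_closed Require Import complex.
Set Implicit Arguments. Unset Strict Implicit. Unset Printing Implicit Defensive.
Import Order.TTheory GRing.Theory Num.Theory.
Local Open Scope ring_scope.

Definition ctrmx (R : realType) (m n : nat) (A : 'M[R[i]]_(m, n)) : 'M[R[i]]_(n, m) :=
  (map_mx Num.conj A)^T.

Definition psd (R : realType) (n : nat) (Q : 'M[R[i]]_n) : Prop :=
  ctrmx Q = Q /\ forall v : 'cV[R[i]]_n, 0 <= (ctrmx v *m Q *m v) 0 0.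

(* log |I + A S A^dagger|; the determinant of I + A S A^dagger is real (and >= 1)
   for S PSD, so we take the real part of the determinant. Natural logarithm. *)
Definition logdet (R : realType) (m n : nat) (A : 'M[R[i]]_(m, n)) (S : 'M[R[i]]_n) : R :=
  ln (complex.Re (\det (1%:M + A *m S *m ctrmx A))).

(* Secrecy rate of receiver pi_k under encoding order pi (0-indexed: pi k is
   the (k+1)-th encoded receiver). *)
Definition secrecy_rate (R : realType) (K nt ne : nat) (nr : 'I_K -> nat)
  (H : forall k : 'I_K, 'M[R[i]]_(nr k, nt)) (G : 'M[R[i]]_(ne, nt))
  (pi : 'S_K) (Q : 'I_K -> 'M[R[i]]_nt) (k : 'I_K) : R :=
  let S  := \sum_(j < K | (k <= j)%N) Q (pi j) in
  let S' := \sum_(j < K | (k < j)%N) Q (pi j) in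
  (logdet (H (pi k)) S - logdet (H (pi k)) S') - (logdet G S - logdet G S').

Definition feasible (R : realType) (K nt : nat) (P : R) (Q : 'I_K -> 'M[R[i]]_nt) : Prop :=
  (forall k, psd (Q k)) /\ \sum_(k < K) \tr (Q k) <= (P%:C)%C.

Definition weighted_sum (R : realType) (K nt ne : nat) (nr : 'I_K -> nat)
  (H : forall k : 'I_K, 'M[R[i]]_(nr k, nt)) (G : 'M[R[i]]_(ne, nt))
  (w : 'I_K -> R) (pi : 'S_K) (Q : 'I_K -> 'M[R[i]]_nt) : R :=
  \sum_(k < K) w (pi k) * secrecy_rate H G pi Q k.

Definition phi (R : realType) (K nt ne : nat) (nr : 'I_K -> nat)
  (H : forall k : 'I_K, 'M[R[i]]_(nr k, nt)) (G : 'M[R[i]]_(ne, nt))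
  (w : 'I_K -> R) (P : R) (pi : 'S_K) : \bar R :=
  ereal_sup [set (weighted_sum H G w pi Q)%:E | Q in [set Q | feasible P Q]].

(* Main.v *)
Require Import Defs.
From HB Require Import structures.
From mathcomp Require Import all_boot all_order all_algebra all_fingroup.
From mathcomp Require Import all_classical all_reals all_analysis.
From mathcomp.real_closed Require Import complex.
From mathcomp Require Import ring.
Import Order.TTheory GRing.Theory Num.Theory.
Local Open Scope ring_scope.
Set Implicit Arguments. Unset Strict Implicit. Unset Printing Implicit Defensive.

(* A permutation is sorted by exchanging two consecutively encoded receivers, the
   earlier one with the smaller weight v and the later one with the larger weight v1.
   Let V be the covariance encoded after both, T = p p† that of the later and
   Q = q q† that of the earlier receiver; after the exchange they carry T + Q - U
   and U, which affects neither the other receivers nor the total power.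

   A channel H enters through A = H† (1 + H V H†)^-1 H.  For the receiver of weight
   v1, put Y = (1 + p†A p)^-1 p†A q, let U = J Pi J† where J = [p q] and Pi is the
   orthogonal projection onto the graph {(-Y z, z)}, and c = det(1 + Y†Y).  Then
     det(1 + B(T + Q)) <= c det(1 + B U) det(1 + B T)
   for every psd B, with equality for B = A: both sides are det(1 + p†B p) times,
   on the left, the determinant of the Schur complement of 1 + J†B J and, on the
   right, that of its quadratic form on the graph, which dominates the Schur
   complement and coincides with it at Y = (1 + p†B p)^-1 p†B q.
   Take logarithms, and add v times the inequality of the other receiver to v1 - v
   times that of the eavesdropper minus v1 times the equality: log c cancels, and
   the weighted secrecy sum-rate has not decreased. *)

(** * Algebra of the conjugate transpose *)

Section ConjugateTranspose.
Variable C : numClosedFieldType.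
Implicit Types m n p : nat.

(* adjmx and hpsd are ctrmx and psd over an abstract field: over R[i] itself,
   unification unfolds the complex arithmetic and does not terminate in practice. *)
Definition adjmx m n (A : 'M[C]_(m, n)) : 'M[C]_(n, m) := (map_mx Num.conj A)^T.

Lemma adjmxE m n (A : 'M[C]_(m, n)) i j : adjmx A i j = (A j i)^*.
Proof. by rewrite !mxE. Qed.

Lemma adjmx_sesqui m n (A : 'M[C]_(m, n)) :
  adjmx A = map_mx Num.conj A^T.
Proof. by rewrite /adjmx map_trmx. Qed.

Lemma adjmxK m n (A : 'M[C]_(m, n)) : adjmx (adjmx A) = A.
Proof. by apply/matrixP => i j; rewrite !adjmxE conjCK. Qed.

Lemma adjmxD m n (A B : 'M[C]_(m, n)) : adjmx (A + B) = adjmx A + adjmx B.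
Proof. by rewrite /adjmx map_mxD linearD. Qed.

Lemma adjmxB m n (A B : 'M[C]_(m, n)) : adjmx (A - B) = adjmx A - adjmx B.
Proof. by rewrite /adjmx map_mxB linearB. Qed.

Lemma adjmxN m n (A : 'M[C]_(m, n)) : adjmx (- A) = - adjmx A.
Proof. by rewrite /adjmx map_mxN linearN. Qed.

Lemma adjmxM m n p (A : 'M[C]_(m, n)) (B : 'M[C]_(n, p)) :
  adjmx (A *m B) = adjmx B *m adjmx A.
Proof. by rewrite /adjmx map_mxM trmx_mul. Qed.

Lemma adjmx1 n : adjmx (1%:M : 'M[C]_n) = 1%:M.
Proof. by rewrite /adjmx map_mx1 trmx1. Qed.

Lemma adjmxV n (A : 'M[C]_n) : adjmx (invmx A) = invmx (adjmx A).
Proof. by rewrite /adjmx map_invmx trmx_inv. Qed.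

Lemma adjmx_row_mx m n p (A : 'M[C]_(m, n)) (B : 'M[C]_(m, p)) :
  adjmx (row_mx A B) = col_mx (adjmx A) (adjmx B).
Proof. by rewrite /adjmx map_row_mx tr_row_mx. Qed.

Lemma adjmx_col_mx m n p (A : 'M[C]_(m, p)) (B : 'M[C]_(n, p)) :
  adjmx (col_mx A B) = row_mx (adjmx A) (adjmx B).
Proof. by rewrite /adjmx map_col_mx tr_col_mx. Qed.

End ConjugateTranspose.

(** Sylvester's identity: one unipotent block matrix, multiplied to [X] on the right or on the left,
    makes it block triangular with [1 + A B] or [1 + B A] on the diagonal. *)
Lemma det_1mx_mulC (F : comUnitRingType) m n (A : 'M[F]_(m, n)) (B : 'M[F]_(n, m)) :
  \det (1%:M + A *m B) = \det (1%:M + B *m A).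
Proof.
pose X := block_mx 1%:M (- A) B 1%:M.
have <- : \det X = \det (1%:M + A *m B).
  have <- : \det (X *m block_mx 1%:M 0 (- B) 1%:M) = \det X.
    by rewrite det_mulmx det_lblock !det1 !mulr1.
  rewrite mulmx_block !(mulmx1, mul1mx, mulmx0, add0r, mulNmx, mulmxN, opprK).
  by rewrite subrr det_ublock det1 mulr1.
have <- : \det (block_mx 1%:M 0 (- B) 1%:M *m X) = \det X.
  by rewrite det_mulmx det_lblock !det1 !mul1r.
rewrite mulmx_block !(mulmx1, mul1mx, mul0mx, addr0, mulNmx, mulmxN, opprK).
by rewrite addNr det_ublock det1 mul1r addrC.
Qed.

(** * Positive semidefinite matrices and their determinants *)

Section PositiveSemidefinite.
Variable C : numClosedFieldType.
Implicit Types m n : nat.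

Definition hpsd n (A : 'M[C]_n) : Prop :=
  adjmx A = A /\ forall v : 'cV[C]_n, 0 <= (adjmx v *m A *m v) 0 0.

Lemma hpsd_gram m n (Z : 'M[C]_(m, n)) : hpsd (Z *m adjmx Z).
Proof.
split=> [|v]; first by rewrite adjmxM adjmxK.
rewrite mulmxA -mulmxA -[adjmx Z *m v]adjmxK adjmxM adjmxK mxE.
by apply: sumr_ge0 => i _; rewrite adjmxE mul_conjC_ge0.
Qed.

Lemma hpsd_congr m n (A : 'M[C]_n) (Z : 'M[C]_(n, m)) :
  hpsd A -> hpsd (adjmx Z *m A *m Z).
Proof.
move=> [hA pA]; split=> [|v]; first by rewrite !adjmxM adjmxK hA mulmxA.
by have := pA (Z *m v); rewrite adjmxM !mulmxA.
Qed.

Lemma hpsdD n (A B : 'M[C]_n) : hpsd A -> hpsd B -> hpsd (A + B).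
Proof.
move=> [hA pA] [hB pB]; split=> [|v]; first by rewrite adjmxD hA hB.
by rewrite mulmxDr mulmxDl mxE addr_ge0.
Qed.

Lemma hpsd0 n : hpsd (0 : 'M[C]_n).
Proof. by have := @hpsd_gram n n 0; rewrite mul0mx. Qed.

Lemma hpsd1 n : hpsd (1%:M : 'M[C]_n).
Proof. by have := hpsd_gram (1%:M : 'M[C]_n); rewrite adjmx1 mulmx1. Qed.

Lemma hpsd_inv n (A : 'M[C]_n) : hpsd A -> hpsd (invmx A).
Proof.
(* [invmx] returns a singular matrix unchanged. *)
move=> pA; have [uA|/negPf uA] := boolP (A \in unitmx); last first.
  by rewrite /invmx uA.
have := hpsd_congr (invmx A) pA.
by rewrite adjmxV (proj1 pA) mulVmx // mul1mx.
Qed.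

Lemma hpsd_spectral n (A : 'M[C]_n) : hpsd A ->
  exists (U : 'M[C]_n) (d : 'rV[C]_n), [/\ adjmx U *m U = 1%:M,
    A = adjmx U *m diag_mx d *m U & forall i, 0 <= d 0 i].
Proof.
move=> [hA pA]; have nA : A \is normalmx.
  by apply/normalmxP; rewrite -adjmx_sesqui hA.
set U := spectralmx A; have uU : U \is unitarymx by apply: spectral_unitarymx.
have Ui : adjmx U = invmx U by rewrite invmx_unitary // -adjmx_sesqui.
have unU : U \in unitmx by apply: unitarymx_unit.
have: A = adjmx U *m diag_mx (spectral_diag A) *m U.
  by rewrite Ui; apply/orthomx_spectralP.
move: (spectral_diag A) => d eA; clearbody U; exists U, d.
split=> // [|i]; first by rewrite Ui mulVmx.
(* Testing the form on the eigenvector [U† e_i] isolates the eigenvalue [d_i]. *)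
have := pA (adjmx U *m delta_mx i 0).
rewrite adjmxM adjmxK eA -!mulmxA (mulmxA U) Ui mulmxV // mul1mx.
rewrite mulKVmx // mul_diag_mx mxE (bigD1 i) //= big1 => [|j ji].
  by rewrite !mxE !eqxx /= conjC1 mul1r mulr1 addr0.
by rewrite !mxE (negPf ji) /= mulr0 mulr0.
Qed.

Lemma hpsd_factor n (A : 'M[C]_n) : hpsd A ->
  exists Z : 'M[C]_n, A = Z *m adjmx Z.
Proof.
move=> /hpsd_spectral [U [d [_ -> d0]]].
exists (adjmx U *m diag_mx (map_mx sqrtC d)).
rewrite adjmxM adjmxK !mulmxA; congr (_ *m _); rewrite -mulmxA; congr (_ *m _).
have -> : adjmx (diag_mx (map_mx sqrtC d)) = diag_mx (map_mx sqrtC d).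
  apply/matrixP => i j; rewrite adjmxE !mxE eq_sym.
  case: eqP => [->|_]; last by rewrite !mulr0n conjC0.
  by rewrite !mulr1n; apply/CrealP/ger0_real; rewrite sqrtC_ge0.
apply/matrixP => i j; rewrite mul_diag_mx !mxE.
case: eqP => [->|_]; last by rewrite !mulr0n mulr0.
by rewrite !mulr1n -expr2 sqrtCK.
Qed.

Lemma det_hpsd_ge0 n (A : 'M[C]_n) : hpsd A -> 0 <= \det A.
Proof.
move=> /hpsd_factor [Z ->]; rewrite det_mulmx /adjmx det_tr det_map_mx.
exact: mul_conjC_ge0.
Qed.

Lemma det_1_hpsd_ge1 n (A : 'M[C]_n) : hpsd A -> 1 <= \det (1%:M + A).
Proof.
move=> /hpsd_spectral [U [d [UU -> d0]]].
have -> : 1%:M + adjmx U *m diag_mx d *m U =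
    adjmx U *m diag_mx (const_mx 1 + d) *m U.
  by rewrite linearD /= mulmxDr mulmxDl diag_const_mx mulmx1 UU.
rewrite !det_mulmx mulrAC -det_mulmx UU det1 mul1r det_diag.
elim/big_ind: _ => // [x y|i _]; first exact: mulr_ege1.
by rewrite !mxE lerDl.
Qed.

Lemma unitmx_1_hpsd n (A : 'M[C]_n) : hpsd A -> 1%:M + A \in unitmx.
Proof.
move=> /det_1_hpsd_ge1 h; rewrite unitmxE unitfE.
by rewrite gt_eqF // (lt_le_trans ltr01).
Qed.

(** For invertible [A] and [B = Z Z†], the quotient of the determinants is
    [det(1 + Z† A^-1 Z) >= 1]; a singular [A] has determinant 0. *)
Lemma det_hpsd_mono n (A B : 'M[C]_n) :
  hpsd A -> hpsd B -> \det A <= \det (A + B).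
Proof.
move=> pA pB; have [uA|] := boolP (A \in unitmx); last first.
  rewrite unitmxE unitfE negbK => /eqP ->.
  by apply: det_hpsd_ge0; apply: hpsdD.
have [Z eB] := hpsd_factor pB.
have -> : A + B = A *m (1%:M + (invmx A *m Z) *m adjmx Z).
  by rewrite mulmxDr mulmx1 !mulmxA mulmxV // mul1mx -eB.
rewrite det_mulmx det_1mx_mulC mulmxA ler_peMr ?det_hpsd_ge0 //.
apply: det_1_hpsd_ge1.
by have := hpsd_congr Z (hpsd_inv pA).
Qed.

(** * Schur complements and compression to a graph *)

(* Here d - Y0† a Y0 is the Schur complement of a. *)
Lemma graph_block_mx m n (a : 'M[C]_m) (d : 'M[C]_n) (Y0 Y : 'M[C]_(m, n)) :
    adjmx a = a ->
  adjmx (col_mx (- Y) 1%:M) *m block_mx a (a *m Y0) (adjmx Y0 *m a) d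
    *m col_mx (- Y) 1%:M =
  d - adjmx Y0 *m a *m Y0 + adjmx (Y - Y0) *m a *m (Y - Y0).
Proof.
move=> ha; rewrite adjmx_col_mx adjmx1 -mulmxA mul_block_col mul_row_col.
rewrite adjmxN adjmxB !mul1mx !mulmx1 !(mulmxDl, mulmxDr, mulmxN, mulNmx, opprK).
rewrite !mulmxA.
set x := _ *m a *m _; set y := _ *m a *m _.
rewrite (addrC _ x) (addrCA _ x) [RHS]addrA subrK.
by rewrite addrA addrC (addrAC y).
Qed.

Lemma det_block_schur m n (a : 'M[C]_m) (b : 'M[C]_(m, n)) (c : 'M[C]_(n, m))
    (d : 'M[C]_n) : a \in unitmx ->
  \det (block_mx a b c d) = \det a * \det (d - c *m invmx a *m b).
Proof.
move=> ua.
have -> : block_mx a b c d = block_mx 1%:M 0 (c *m invmx a) 1%:M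
    *m block_mx a b 0 (d - c *m invmx a *m b).
  rewrite mulmx_block !(mul1mx, mul0mx, mulmx0, addr0).
  by rewrite mulmxKV // addrC subrK.
by rewrite det_mulmx det_lblock !det1 !mul1r det_ublock.
Qed.

Lemma graph_gram_unit m n (Y : 'M[C]_(m, n)) :
  let E := col_mx (- Y) 1%:M in
  1 <= \det (adjmx E *m E) /\ adjmx E *m E \in unitmx.
Proof.
move=> E; have -> : adjmx E *m E = 1%:M + adjmx Y *m Y.
  rewrite /E adjmx_col_mx mul_row_col adjmxN adjmx1 mulmx1 mulNmx mulmxN opprK.
  by rewrite addrC.
have hY : hpsd (adjmx Y *m Y) by rewrite -{2}[Y]adjmxK; apply: hpsd_gram.
by split; [apply: det_1_hpsd_ge1 | apply: unitmx_1_hpsd].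
Qed.

(* p p† + q q† compressed by the orthogonal projection onto the graph of -Y. *)
Definition flip n k l (p : 'M[C]_(n, k)) (q : 'M[C]_(n, l)) (Y : 'M[C]_(k, l)) :=
  let F := row_mx p q *m col_mx (- Y) 1%:M in
  F *m invmx (adjmx (col_mx (- Y) 1%:M) *m col_mx (- Y) 1%:M) *m adjmx F.

Lemma hpsd_flip n k l (p : 'M[C]_(n, k)) (q : 'M[C]_(n, l)) (Y : 'M[C]_(k, l)) :
  hpsd (flip p q Y).
Proof.
rewrite /flip; set F := row_mx p q *m _; set E := col_mx _ _.
rewrite -{1}[F]adjmxK; apply/hpsd_congr/hpsd_inv.
by rewrite -{2}[E]adjmxK; apply: hpsd_gram.
Qed.

(** With [J = [p q]] and [N] the projection onto the orthogonal complement of the graph, the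
    difference is [J N J† = (J N)(J N)†]. *)
Lemma hpsd_sub_flip n k l (p : 'M[C]_(n, k)) (q : 'M[C]_(n, l)) (Y : 'M[C]_(k, l)) :
  hpsd (p *m adjmx p + q *m adjmx q - flip p q Y).
Proof.
have [_] := graph_gram_unit Y; rewrite /flip.
set E := col_mx _ _; set r := adjmx E *m E; set J := row_mx p q => ur.
set N := 1%:M - E *m invmx r *m adjmx E.
have hr : adjmx r = r by rewrite /r adjmxM adjmxK.
have NN : N *m adjmx N = N.
  have -> : adjmx N = N.
    by rewrite /N adjmxB adjmx1 !adjmxM adjmxK adjmxV hr mulmxA.
  rewrite {2}/N mulmxBr mulmx1 !mulmxA /N mulmxBl mul1mx.
  by rewrite -!(mulmxA _ (adjmx E) E) -/r mulmxKV // subrr !mul0mx subr0.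
have -> : p *m adjmx p + q *m adjmx q - J *m E *m invmx r *m adjmx (J *m E) =
    J *m N *m adjmx J.
  have -> : p *m adjmx p + q *m adjmx q = J *m adjmx J.
    by rewrite /J adjmx_row_mx mul_row_col.
  by rewrite /N mulmxBr mulmx1 mulmxBl adjmxM !mulmxA.
by rewrite -NN -mulmxA -mulmxA -adjmxM mulmxA; apply: hpsd_gram.
Qed.

(** Reduces the determinants of the exchange to [a] and the Schur complement [s] of [1 + J† B J];
    the form on the graph of [-Y] exceeds [s] by a term that vanishes at [Y = Z]. *)
Lemma det_flip n k l (p : 'M[C]_(n, k)) (q : 'M[C]_(n, l)) (Y : 'M[C]_(k, l))
    (B : 'M[C]_n) (a := 1%:M + adjmx p *m B *m p)
    (Z := invmx a *m (adjmx p *m B *m q))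
    (E := col_mx (- Y) 1%:M) : hpsd B ->
  exists s : 'M[C]_l, [/\ hpsd s,
    \det (1%:M + B *m (p *m adjmx p + q *m adjmx q)) = \det a * \det s,
    \det (1%:M + B *m (p *m adjmx p)) = \det a &
    \det (1%:M + B *m flip p q Y) * \det (adjmx E *m E) =
      \det (s + adjmx (Y - Z) *m a *m (Y - Z))].
Proof.
move=> pB; have [hB _] := pB; set J := row_mx p q.
have pp : hpsd (adjmx p *m B *m p) by apply: hpsd_congr.
have ua : a \in unitmx by apply: unitmx_1_hpsd.
have ha : adjmx a = a by rewrite adjmxD adjmx1 (proj1 pp).
pose d := 1%:M + adjmx q *m B *m q.
have eM : 1%:M + adjmx J *m B *m J = block_mx a (a *m Z) (adjmx Z *m a) d.
  rewrite /Z mulKVmx // adjmxM adjmxV ha mulmxKV // !adjmxM adjmxK hB.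
  rewrite /J adjmx_row_mx mul_col_mx mul_col_row scalar_mx_block.
  by rewrite add_block_mx !add0r mulmxA.
have pM : hpsd (1%:M + adjmx J *m B *m J).
  by apply: hpsdD; [apply: hpsd1 | apply: hpsd_congr].
pose s := d - adjmx Z *m a *m Z.
have es W : adjmx (col_mx (- W) 1%:M) *m (1%:M + adjmx J *m B *m J)
    *m col_mx (- W) 1%:M = s + adjmx (W - Z) *m a *m (W - Z).
  by rewrite eM graph_block_mx.
exists s; split.
- have := es Z; rewrite subrr mulmx0 addr0 => <-; exact: hpsd_congr.
- have -> : p *m adjmx p + q *m adjmx q = J *m adjmx J.
    by rewrite /J adjmx_row_mx mul_row_col.
  rewrite mulmxA det_1mx_mulC mulmxA eM det_block_schur //.
  by rewrite mulmxA mulmxKV // -mulmxA.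
- by rewrite mulmxA det_1mx_mulC mulmxA.
rewrite -es /flip -/E -/J; set r := adjmx E *m E.
have [_ ur] := graph_gram_unit Y.
have -> : B *m (J *m E *m invmx r *m adjmx (J *m E)) =
    (B *m (J *m E)) *m (invmx r *m adjmx (J *m E)) by rewrite !mulmxA.
(* The factor [det r] clears the inverse and leaves [1 + J† B J] restricted to the graph. *)
rewrite det_1mx_mulC mulrC -det_mulmx (mulmxDr r) (mulmx1 r) -(mulmxA (invmx r)).
rewrite (mulKVmx ur) adjmxM; congr (\det _).
by rewrite mulmxDr mulmxDl mulmx1 !mulmxA.
Qed.

Lemma hpsd_exchange n (A T Q : 'M[C]_n) : hpsd A -> hpsd T -> hpsd Q ->
  exists (U : 'M[C]_n) (c : C), [/\ hpsd U, hpsd (T + Q - U), 1 <= c,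
    \det (1%:M + A *m (T + Q)) =
      \det (1%:M + A *m U) * \det (1%:M + A *m T) * c &
    forall B, hpsd B -> \det (1%:M + B *m (T + Q)) <=
      \det (1%:M + B *m U) * \det (1%:M + B *m T) * c].
Proof.
move=> pA /hpsd_factor[p ->] /hpsd_factor[q ->].
(* This is the [Z] of [det_flip] for [B = A], so the excess over the Schur complement vanishes
   there. *)
pose Y := invmx (1%:M + adjmx p *m A *m p) *m (adjmx p *m A *m q).
have [c1 _] := graph_gram_unit Y.
exists (flip p q Y), (\det (adjmx (col_mx (- Y) 1%:M) *m col_mx (- Y) 1%:M)).
split=> // [||| B pB]; [exact: hpsd_flip | exact: hpsd_sub_flip | |].
  have [s [_ -> -> e]] := det_flip p q Y pA.
  by rewrite mulrAC e subrr mulmx0 addr0 mulrC.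
have [s [ps -> -> e]] := det_flip p q Y pB.
have pa : hpsd (adjmx p *m B *m p) by apply: hpsd_congr.
rewrite mulrAC e mulrC ler_wpM2r ?(le_trans ler01) ?det_1_hpsd_ge1 //.
apply: det_hpsd_mono => //; apply: hpsd_congr.
by apply: hpsdD => //; apply: hpsd1.
Qed.

(** * Channel determinants relative to a base covariance *)

Definition det_gain m n (H : 'M[C]_(m, n)) (S : 'M[C]_n) :=
  \det (1%:M + H *m S *m adjmx H).

Lemma hpsd_gain m n (H : 'M[C]_(m, n)) (S : 'M[C]_n) :
  hpsd S -> hpsd (H *m S *m adjmx H).
Proof. by move=> pS; rewrite -{1}[H]adjmxK; apply: hpsd_congr. Qed.

Lemma det_gain_ge1 m n (H : 'M[C]_(m, n)) (S : 'M[C]_n) :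
  hpsd S -> 1 <= det_gain H S.
Proof. by move=> pS; apply/det_1_hpsd_ge1/hpsd_gain. Qed.

(** Factor [k = 1 + H V H†] out of [k + H X H†] and apply Sylvester's identity; this gives
    [A = H† k^-1 H]. *)
Lemma det_gain_rebase m n (H : 'M[C]_(m, n)) (V : 'M[C]_n) : hpsd V ->
  exists2 A : 'M[C]_n, hpsd A & forall X,
    det_gain H (V + X) = det_gain H V * \det (1%:M + A *m X).
Proof.
move=> pV; rewrite /det_gain; set k := 1%:M + H *m V *m adjmx H.
have uk : k \in unitmx by apply/unitmx_1_hpsd/hpsd_gain.
exists (adjmx H *m invmx k *m H) => [|X].
  by apply/hpsd_congr/hpsd_inv/hpsdD; [apply: hpsd1 | apply: hpsd_gain].
have -> : adjmx H *m invmx k *m H *m X = adjmx H *m (invmx k *m (H *m X)).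
  by rewrite !mulmxA.
rewrite (det_1mx_mulC (adjmx H)) -det_mulmx (mulmxDr k) (mulmx1 k).
rewrite -(mulmxA (invmx k)) mulKVmx //.
by rewrite mulmxDr mulmxDl addrA.
Qed.

(** The extra factor at [V] lets both sides carry the square of the determinant at [V] after
    rebasing. *)
Lemma det_gain_exchange m n (H : 'M[C]_(m, n)) (V T Q : 'M[C]_n) :
    hpsd V -> hpsd T -> hpsd Q ->
  exists (U : 'M[C]_n) (c : C), [/\ hpsd U, hpsd (T + Q - U), 1 <= c,
    det_gain H (V + (T + Q)) * det_gain H V =
      det_gain H (V + U) * det_gain H (V + T) * c &
    forall m' (G : 'M[C]_(m', n)), det_gain G (V + (T + Q)) * det_gain G V <=
      det_gain G (V + U) * det_gain G (V + T) * c].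
Proof.
move=> pV pT pQ; have [A pA eA] := det_gain_rebase H pV.
have [U [c [pU pTQU c1 e h]]] := hpsd_exchange pA pT pQ.
exists U, c; split=> // [|m' G]; first by rewrite !eA e; ring.
have [B pB eB] := det_gain_rebase G pV; rewrite !eB.
have g0 : 0 <= det_gain G V by rewrite (le_trans ler01) ?det_gain_ge1.
rewrite mulrAC [leRHS](_ : _ = det_gain G V * det_gain G V *
  (\det (1%:M + B *m U) * \det (1%:M + B *m T) * c)); last by ring.
by rewrite ler_wpM2l ?mulr_ge0 // h.
Qed.

End PositiveSemidefinite.

(** * From complex determinants to real logarithms *)

Section LogDet.
Variables (R : realType) (n : nat).
Implicit Types V T Q U : 'M[R[i]]_n.

(** The order of [R[i]] compares only numbers with equal imaginary parts, so anything above 1 is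
    real. *)
Lemma ge1_complexP (z : R[i]) : 1 <= z -> z = (complex.Re z)%:C%C /\ 1 <= complex.Re z.
Proof. by case: z => a b; rewrite lecE /= => /andP[/eqP -> ->]. Qed.

Lemma ln_Re_mul (x y : R[i]) : 1 <= x -> 1 <= y ->
  ln (complex.Re (x * y)) = ln (complex.Re x) + ln (complex.Re y).
Proof.
move=> /ge1_complexP[-> x1] /ge1_complexP[-> y1].
by rewrite -rmorphM /= lnM // posrE (lt_le_trans ltr01).
Qed.

Lemma ler_ln_Re (x y : R[i]) : 1 <= x -> x <= y ->
  ln (complex.Re x) <= ln (complex.Re y).
Proof.
move=> x1 xy; have /ge1_complexP[_ y1] := le_trans x1 xy.
have /ge1_complexP[_ {}x1] := x1.
rewrite ler_ln ?posrE ?(lt_le_trans ltr01) //.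
by move: xy; rewrite lecE => /andP[].
Qed.

Lemma psd_hpsd Q : psd Q <-> hpsd Q.
Proof. exact: iff_refl. Qed.

Lemma logdetE m (H : 'M[R[i]]_(m, n)) S :
  logdet H S = ln (complex.Re (det_gain H S)).
Proof. exact: erefl. Qed.

Lemma logdet_exchange m (H : 'M[R[i]]_(m, n)) V T Q : hpsd V -> hpsd T -> hpsd Q ->
  exists U (c : R), [/\ hpsd U, hpsd (T + Q - U),
    logdet H (V + (T + Q)) + logdet H V = logdet H (V + U) + logdet H (V + T) + c &
    forall m' (G : 'M[R[i]]_(m', n)), logdet G (V + (T + Q)) + logdet G V <=
      logdet G (V + U) + logdet G (V + T) + c].
Proof.
move=> pV pT pQ.
have [U [c [pU pTQU c1 e h]]] := det_gain_exchange H pV pT pQ.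
exists U, (ln (complex.Re c)).
have ge1 m' (G : 'M[R[i]]_(m', n)) X : hpsd X -> 1 <= det_gain G (V + X).
  by move=> pX; apply/det_gain_ge1/hpsdD.
have V1 m' (G : 'M[R[i]]_(m', n)) : 1 <= det_gain G V by apply: det_gain_ge1.
have pTQ : hpsd (T + Q) by apply: hpsdD.
have lnM3 m' (G : 'M[R[i]]_(m', n)) :
    ln (complex.Re (det_gain G (V + U) * det_gain G (V + T) * c)) =
    logdet G (V + U) + logdet G (V + T) + ln (complex.Re c).
  rewrite !logdetE; move: (ge1 _ G _ pU) (ge1 _ G _ pT).
  move: (det_gain G (V + U)) (det_gain G (V + T)) => x y x1 y1.
  by rewrite (ln_Re_mul (mulr_ege1 x1 y1) c1) (ln_Re_mul x1 y1).
have lnM2 m' (G : 'M[R[i]]_(m', n)) :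
    ln (complex.Re (det_gain G (V + (T + Q)) * det_gain G V)) =
    logdet G (V + (T + Q)) + logdet G V.
  rewrite !logdetE; move: (ge1 _ G _ pTQ) (V1 _ G).
  by move: (det_gain G (V + (T + Q))) (det_gain G V) => x y; apply: ln_Re_mul.
split=> [||| m' G].
- exact: pU.
- exact: pTQU.
- pose lnRe (z : R[i]) := ln (complex.Re z).
  exact: etrans (esym (lnM2 _ H)) (etrans (congr1 lnRe e) (lnM3 _ H)).
have le_eqs (a b a' b' : R) : a = a' -> b = b' -> a <= b -> a' <= b' by move=> -> ->.
apply: le_eqs (lnM2 _ G) (lnM3 _ G) (ler_ln_Re _ (h _ G)).
exact: mulr_ege1 (ge1 _ G _ pTQ) (V1 _ G).
Qed.

End LogDet.

(** * Permutations without descents *)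

(** Both [s] and its inverse are strictly increasing, and such a map moves no index down; hence
    [i <= s i] and [s i <= s^-1 (s i) = i]. *)
Lemma perm_ord_mono_id K (s : 'S_K) :
  (forall i j : 'I_K, j = i.+1 :> nat -> (s i <= s j)%N) -> s = 1%g.
Proof.
move=> s_asc; have le_s (i j : 'I_K) : (i <= j)%N -> (s i <= s j)%N.
  case: j => j; elim: j => [|j IHj] ltjK /=.
    by rewrite leqn0 => /eqP i0; rewrite (_ : i = Ordinal ltjK) //; apply/val_inj.
  have ltj : (j < K)%N := ltnW ltjK.
  rewrite leq_eqVlt => /orP[/eqP eij|ltij].
    by rewrite (_ : i = Ordinal ltjK) //; apply/val_inj.
  by apply: leq_trans (IHj ltj ltij) _; apply: s_asc.
have ge_id (t : 'S_K) : (forall i j : 'I_K, (i < j)%N -> (t i < t j)%N) ->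
    forall i : 'I_K, (i <= t i)%N.
  move=> lt_t [k]; elim: k => // k IHk ltkK.
  have ltk : (k < K)%N := ltnW ltkK.
  exact: leq_ltn_trans (IHk ltk) (lt_t (Ordinal ltk) (Ordinal ltkK) (ltnSn k)).
have lt_sV (i j : 'I_K) : (i < j)%N -> (s^-1 i < s^-1 j)%g%N.
  apply: contraTT; rewrite -!leqNgt => /le_s; by rewrite !permKV.
have lt_s (i j : 'I_K) : (i < j)%N -> (s i < s j)%N.
  move=> ltij; rewrite ltn_neqAle le_s 1?ltnW // andbT.
  by apply: contraTneq ltij => /val_inj/perm_inj ->; rewrite ltnn.
apply/permP => i; rewrite perm1; apply/val_inj/eqP.
by rewrite /= eqn_leq ge_id // andbT -{2}(permK s i) ge_id.
Qed.

(** * Exchange of two consecutive receivers *)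

(** [S], [T], [U], [V] label cumulative covariances, [h] a receiver, [g] the eavesdropper; suffix 1
    marks the receiver of weight [v1]. The gain is exactly [m1 + m2], and [v <= v1] gives the sign
    of [m2]. *)
Lemma exchange_gain (R : realType) (v v1 c hS hT hU hV hS1 hT1 hU1 hV1 gS gT gU gV : R) :
    0 <= v -> v <= v1 ->
    hS1 + hV1 = hU1 + hT1 + c ->
    hS + hV <= hU + hT + c -> gS + gV <= gU + gT + c ->
  v * (hS - gS - (hT - gT)) + v1 * (hT1 - gT - (hV1 - gV)) <=
  v1 * (hS1 - gS - (hU1 - gU)) + v * (hU - gU - (hV - gV)).
Proof.
move=> v0 v1v e hH hG.
have m1 : 0 <= v * (hU + hT + c - (hS + hV)) by rewrite mulr_ge0 // subr_ge0.
have m2 : 0 <= (v1 - v) * (gU + gT + c - (gS + gV)) by rewrite mulr_ge0 // subr_ge0.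
rewrite -subr_ge0; apply: le_trans (addr_ge0 m1 m2) _.
have -> : c = hS1 + hV1 - hU1 - hT1 by rewrite e; ring.
by rewrite le_eqVlt; apply/orP; left; apply/eqP; ring.
Qed.

Section AdjacentExchange.
Variables (R : realType) (K nt ne : nat) (nr : 'I_K -> nat).
Variables (H : forall k : 'I_K, 'M[R[i]]_(nr k, nt)) (G : 'M[R[i]]_(ne, nt)).
Variables (w : 'I_K -> R).
Hypothesis w_ge0 : forall k, 0 <= w k.

(** The index is a natural number, so that past the last position the sum is empty. *)
Definition residual (pi : 'S_K) (Q : 'I_K -> 'M[R[i]]_nt) (m : nat) :=
  \sum_(j < K | (m <= j)%N) Q (pi j).

Definition secrecy_logdet (k : 'I_K) S := logdet (H k) S - logdet G S.

(** Each rate becomes the increment of one function between successive residuals, so only residuals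
    need tracking. *)
Lemma weighted_sumE pi Q : weighted_sum H G w pi Q =
  \sum_(k < K) w (pi k) * (secrecy_logdet (pi k) (residual pi Q k) -
                            secrecy_logdet (pi k) (residual pi Q k.+1)).
Proof.
apply: eq_bigr => k _; congr (_ * _).
have subrACA (a b c d : R) : (a - b) - (c - d) = (a - c) - (b - d) by ring.
exact: subrACA.
Qed.

Lemma residual_rec pi Q (k : 'I_K) :
  residual pi Q k = residual pi Q k.+1 + Q (pi k).
Proof.
rewrite /residual (bigD1 k) //= addrC; congr (_ + _); apply: eq_bigl => j.
by rewrite ltn_neqAle andbC eq_sym.
Qed.

Lemma psd_residual pi Q m : (forall k, psd (Q k)) -> psd (residual pi Q m).
Proof.
move=> pQ; apply/psd_hpsd; apply: (big_ind (@hpsd _ nt)) => [|A B|j _].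
- exact: hpsd0.
- exact: hpsdD.
- by apply/psd_hpsd; apply: pQ.
Qed.

Variables (P : R) (pi : 'S_K) (i i1 : 'I_K).
Hypotheses (i1E : i1 = i.+1 :> nat) (w_le : w (pi i) <= w (pi i1)).

Lemma weighted_sum_exchange Q : feasible P Q ->
  exists2 Q', feasible P Q' &
    weighted_sum H G w pi Q <= weighted_sum H G w (tperm i i1 * pi)%g Q'.
Proof.
move=> [pQ trQ]; set pi' := (tperm i i1 * pi)%g.
have ne_i : i1 != i by rewrite -val_eqE /= i1E gtn_eqF.
have ne_pi : pi i1 != pi i by rewrite (inj_eq perm_inj).
have pi'i : pi' i = pi i1 by rewrite permM tpermL.
have pi'i1 : pi' i1 = pi i by rewrite permM tpermR.
have pi'D k : k != i -> k != i1 -> pi' k = pi k.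
  by move=> ki ki1; rewrite permM tpermD // eq_sym.
set V := residual pi Q i.+2.
have hQ k : hpsd (Q k) by apply/psd_hpsd; apply: pQ.
have pV : hpsd V by apply/psd_hpsd/psd_residual.
have [U [c [pU pTQU e h]]] :=
  logdet_exchange (H (pi i1)) pV (hQ (pi i1)) (hQ (pi i)).
pose Q' k := if k == pi i then U else
             if k == pi i1 then Q (pi i1) + Q (pi i) - U else Q k.
have Q'i : Q' (pi i) = U by rewrite /Q' eqxx.
have Q'i1 : Q' (pi i1) = Q (pi i1) + Q (pi i) - U.
  by rewrite /Q' (negPf ne_pi) eqxx.
have Q'D k : k != pi i -> k != pi i1 -> Q' k = Q k.
  by rewrite /Q' => /negPf -> /negPf ->.
have resS : residual pi Q i = V + (Q (pi i1) + Q (pi i)).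
  by rewrite residual_rec -i1E residual_rec i1E addrA.
have resT : residual pi Q i.+1 = V + Q (pi i1).
  by rewrite -i1E residual_rec i1E.
have res_gt m : (i1 < m)%N -> residual pi' Q' m = residual pi Q m.
  move=> ltm; apply: eq_bigr => j lemj.
  have ltj := leq_trans ltm lemj.
  have ji1 : j != i1 by rewrite -val_eqE /= gtn_eqF.
  have ji : j != i by rewrite -val_eqE /= gtn_eqF // ltnW // -i1E.
  by rewrite pi'D // Q'D // (inj_eq perm_inj).
have resU : residual pi' Q' i.+1 = V + U.
  by rewrite -i1E residual_rec res_gt // pi'i1 Q'i i1E.
have resS' : residual pi' Q' i = V + (Q (pi i1) + Q (pi i)).
  by rewrite residual_rec resU pi'i Q'i1 -addrA (addrC U) subrK.
(* Only the residual at [i1] changes: later ones involve neither receiver, and at [i] the pair's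
   total is preserved, whence equality descends to earlier positions. *)
have res_ne m : m != i1 :> nat -> residual pi' Q' m = residual pi Q m.
  move=> ne_m; have [/res_gt //|lem] := ltnP i1 m.
  have {lem ne_m} : (m <= i)%N by rewrite -ltnS -i1E ltn_neqAle ne_m.
  move=> /subnKC; move: (i - m)%N => d.
  elim: d m => [m|d IHd m]; first by rewrite addn0 => ->; rewrite resS'.
  move=> em; have ltm : (m < i)%N by rewrite -em addnS ltnS leq_addr.
  have ltmK := ltn_trans ltm (ltn_ord i).
  have mi : Ordinal ltmK != i by rewrite -val_eqE /= ltn_eqF.
  have mi1 : Ordinal ltmK != i1 by rewrite -val_eqE /= ltn_eqF // i1E ltnW.
  have := residual_rec pi' Q' (Ordinal ltmK); rewrite /= => ->.
  have := residual_rec pi Q (Ordinal ltmK); rewrite /= => ->.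
  by rewrite IHd ?addSnnS // pi'D // Q'D // (inj_eq perm_inj).
exists Q'; first split.
- move=> k; apply/psd_hpsd; rewrite /Q'; case: ifP => _; first exact: pU.
  by case: ifP => _; [exact: pTQU | exact: hQ].
- rewrite (_ : \sum_k _ = \sum_k \tr (Q k)) //.
  rewrite (bigD1 (pi i)) //= (bigD1 (pi i1)) //= [RHS](bigD1 (pi i)) //=.
  rewrite [in RHS](bigD1 (pi i1)) //= !addrA; congr (_ + _).
    by rewrite -!raddfD Q'i Q'i1 (addrC U) subrK (addrC (Q (pi i1))).
  by apply: eq_bigr => k /andP[ki ki1]; rewrite Q'D.
have sum2 (F : 'I_K -> R) :
    \sum_k F k = F i + F i1 + \sum_(k | (k != i) && (k != i1)) F k.
  by rewrite (bigD1 i) //= (bigD1 i1) //= addrA.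
pose t (s : 'S_K) S (k : 'I_K) := w (s k) * (secrecy_logdet (s k) (residual s S k) -
                           secrecy_logdet (s k) (residual s S k.+1)).
have ws2 s S := etrans (weighted_sumE s S) (sum2 (t s S)).
rewrite (ws2 pi Q) (ws2 pi' Q'); apply: lerD; last first.
  apply: ler_sum => k /andP[ki ki1].
  (* [k.+1 = i1] would force [k = i], so the other rates avoid the changed residual. *)
  have k1 : k.+1 != i1 :> nat by rewrite i1E eqSS.
  by rewrite /t (pi'D _ ki ki1) (res_ne _ ki1) (res_ne _ k1).
have resV : residual pi' Q' i1.+1 = V by rewrite res_gt ?i1E.
rewrite /t resV i1E resS' resU resS resT pi'i pi'i1 -/V.
exact: exchange_gain (w_ge0 _) w_le e (h _ (H (pi i))) (h _ G).
Qed.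

Lemma phi_exchange : (phi H G w P pi <= phi H G w P (tperm i i1 * pi)%g)%E.
Proof.
apply: ub_ereal_sup => _ [Q fQ <-].
have [Q' fQ' le] := weighted_sum_exchange fQ.
apply: (@le_trans _ _ (weighted_sum H G w (tperm i i1 * pi)%g Q')%:E).
  by rewrite lee_fin.
by apply: ereal_sup_ubound; exists Q'.
Qed.

End AdjacentExchange.

(** * Sorting the encoding order *)

Theorem theorem1 (R : realType) (K nt ne : nat) (nr : 'I_K -> nat)
  (H : forall k : 'I_K, 'M[R[i]]_(nr k, nt)) (G : 'M[R[i]]_(ne, nt))
  (P : R) (w : 'I_K -> R)
  (hP : 0 < P)
  (hw0 : forall k, 0 <= w k)
  (hw1 : \sum_(k < K) w k = 1)
  (pistar : 'S_K)
  (hord : forall i j : 'I_K, (i <= j)%N -> w (pistar j) <= w (pistar i)) :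
  forall pi : 'S_K, (phi H G w P pi <= phi H G w P pistar)%E.
Proof.
(* Ranks in [pistar], unlike weights, have no ties, so the sorted order is unique. *)
move=> pi; pose rank (s : 'S_K) k := (pistar^-1 (s k))%g.
(* Exchanging a descent of rank strictly increases the score. *)
pose score (s : 'S_K) := (\sum_(k < K) k * rank s k)%N.
(* Among the finitely many orders at least as good as [pi], one of maximal score has no descent,
   hence is [pistar]. *)
have := @arg_maxnP _ pi (fun s => phi H G w P pi <= phi H G w P s)%E score (lexx _).
case=> s le_s max_s; suff -> : pistar = s by [].
suff s1 : (s * pistar^-1)%g = 1%g by rewrite -[s](mulgKV pistar) s1 mul1g.
apply: perm_ord_mono_id => i i1 i1E; rewrite !permM leqNgt; apply/negP => lt_r.
have ne_i : i1 != i by rewrite -val_eqE /= i1E gtn_eqF.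
have w_le : w (s i) <= w (s i1).
  have := hord _ _ (ltnW lt_r); by rewrite !permKV.
have scoreE (u : 'S_K) : score u = (i * rank u i + i1 * rank u i1 +
    \sum_(k < K | (k != i) && (k != i1)) k * rank u k)%N.
  by rewrite /score (bigD1 i) //= (bigD1 i1) //= addnA.
have := max_s (tperm i i1 * s)%g (le_trans le_s (phi_exchange H G hw0 P i1E w_le)).
rewrite /geq /= !scoreE.
rewrite [X in (_ + X <= _)%N](eq_bigr (fun k : 'I_K => k * rank s k)%N); last first.
  by move=> k /andP[ki ki1]; rewrite /rank permM tpermD // eq_sym.
rewrite leq_add2r /rank !permM tpermL tpermR i1E leqNgt => /negP; apply.
by rewrite !mulSn addnCA [ltnRHS]addnCA (addnC (i * _)%N) ltn_add2r.
Qed.
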